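(* Let $X$ be a Polish space without isolated points, and let $A\subseteq B\subseteq C\subseteq X$ be sets such that $A$ is an $F_\sigma$-set, $B\neq\emptyset$ is regular closed, and $C$ is closed. Then there exists a sequence $x$ taking values in $X$ such that $$\Lambda_x=A,\quad \Gamma_x=B,\quad\text{and}\quad \mathrm{L}_x=C.$$
   Context: $\mathbf{N}$ denotes the positive integers. Let $\mathcal{I}_0$ be the ideal of sets of zero asymptotic density, $\mathcal{I}_0:=\{T\subseteq\mathbf{N}:\lim_{n\to\infty}|T\cap\{1,\ldots,n\}|/n=0\}$. For a sequence $x=(x_n)_{n\in\mathbf{N}}$ in $X$: $\Lambda_x$ (the statistical limit points) is the set of all $\ell\in X$ such that $\lim_{k\to\infty}x_{n_k}=\ell$ for some subsequence $(x_{n_k})$ with $\{n_k:k\in\mathbf{N}\}\notin\mathcal{I}_0$. $\Gamma_x$ (the statistical cluster points) is the set of all $\ell\in X$ such that $\{n:x_n\in U\}\notin\mathcal{I}_0$ for every neighborhood $U$ of $\ell$. $\mathrm{L}_x$ (the ordinary limit points) is the set of all limits of convergent subsequences of $x$. A set $R\subseteq X$ is regular closed if it equals the closure of its interior. *)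

(* Defs.v *)
From mathcomp Require Import all_boot all_order all_algebra.
From mathcomp Require Import all_classical all_reals all_analysis.

Set Implicit Arguments.
Unset Strict Implicit.
Unset Printing Implicit Defensive.

Import Order.TTheory GRing.Theory Num.Theory.
Import numFieldNormedType.Exports.

Local Open Scope classical_set_scope.
Local Open Scope ring_scope.

Definition homeomorphic (X Y : topologicalType) : Prop :=
  exists (f : X -> Y) (g : Y -> X),
    [/\ cancel f g, cancel g f, continuous f & continuous g].

(* The library's [completeType] is pointed, so it cannot be used to express
   completeness of a given (possibly empty) metric space. *)
Definition complete_space (M : uniformType) : Prop :=
  forall F : set_system M, ProperFilter F -> cauchy F ->
    exists l : M, F --> l.

Definition separable_space (X : topologicalType) : Prop :=
  exists2 D : set X, countable D & dense D.

Definition polish (R : realType) (X : topologicalType) : Prop :=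
  separable_space X /\
  exists M : metricType R, complete_space M /\ homeomorphic X M.

(* Sequences and sets of indices are zero-based: the index [n : nat] stands for
   the positive integer [n.+1], so that {1, ..., n} is the set of all
   [i : 'I_n], and the term [x n] is the one usually written x_{n+1}. *)
Definition zero_density (R : realType) : set (set nat) :=
  [set T | (#|[pred i : 'I_n | (i : nat) \in T]|%:R / n%:R : R)
             @[n --> \oo] --> (0 : R)].

Section limit_points.
Variables (R : realType) (X : topologicalType) (x : nat -> X).

Definition statistical_limit_points : set X :=
  [set l | exists sigma : nat -> nat,
     [/\ increasing_seq sigma,
         x (sigma k) @[k --> \oo] --> l &
         ~ zero_density R (range sigma)]].

Definition statistical_cluster_points : set X :=
  [set l | forall U : set X, nbhs l U -> ~ zero_density R (x @^-1` U)].

Definition ordinary_limit_points : set X :=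
  [set l | exists sigma : nat -> nat,
     increasing_seq sigma /\ x (sigma k) @[k --> \oo] --> l].

End limit_points.

(* Main.v *)
(* For each k, the indices n with 2-adic valuation v(n + 1) = k have density
   2^-(k+1).  Let x follow a sequence w_k in B on this class, except at the
   indices n + 1 = 2^k, a set of density zero, where x runs through a sequence
   in C having every point of C as a limit point.  This gives L_x = C; it gives
   Gamma_x = B as soon as every neighbourhood of every point of B contains some
   w_k entirely.  Call y diffuse at l if the upper density of {n : y_n in U} is
   arbitrarily small for small neighbourhoods U of l.  If each w_k is diffuse
   off A, so is x, because the classes of index at least K have total density
   2^-K; and diffuseness at l excludes l from Lambda_x.

   Half of the w_k are diffuse everywhere and lie in small balls inside B: the
   binary tree grown at a point of a space without isolated points gives z with
   z_i and z_j far apart unless i = j mod 2^K.  The others lie in the closed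
   sets F_k whose union is A: such a w_k is constant on the dyadic blocks
   [2^j, 2^(j+1)), with the values of a sequence dense in F_k, so that any limit
   point of the values is reached along a set of positive upper density. *)
Require Import Defs.
From mathcomp Require Import all_boot all_order all_algebra.
From mathcomp Require Import all_classical all_reals all_analysis.
From mathcomp Require Import borel_hierarchy.
From mathcomp Require Import zify lra.

Set Implicit Arguments.
Unset Strict Implicit.
Unset Printing Implicit Defensive.

Import Order.TTheory GRing.Theory Num.Theory.
Import numFieldNormedType.Exports.

Local Open Scope classical_set_scope.

(** * Upper densities of sets of indices *)

Definition counting_fun (T : set nat) (n : nat) : nat :=
  #|[pred i : 'I_n | (i : nat) \in T]|.

Lemma counting_funE (T : set nat) n :
  counting_fun T n = (\sum_(0 <= i < n) (i \in T))%N.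
Proof.
rewrite /counting_fun -sum1_card big_mkcond /= big_mkord.
by apply: eq_bigr => i _; rewrite inE; case: ifP.
Qed.

Lemma counting_fun_le (T : set nat) n : counting_fun T n <= n.
Proof. by rewrite /counting_fun (leq_trans (max_card _)) // card_ord. Qed.

Lemma counting_fun_set0 n : counting_fun set0 n = 0%N.
Proof. by rewrite counting_funE big1 // => i _; rewrite in_set0. Qed.

Lemma counting_funU (S T U : set nat) n :
  (forall i, i < n -> S i -> T i \/ U i) ->
  counting_fun S n <= counting_fun T n + counting_fun U n.
Proof.
move=> STU; rewrite !counting_funE -big_split /= !big_mkord.
apply: leq_sum => i _; case: (boolP (_ \in S)) => //.
move=> /set_mem /(STU _ (ltn_ord i)).
by case=> /mem_set -> //=; rewrite addn1.
Qed.

(** Serves to ignore an initial segment of indices, at the cost of what [S] has there. *)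
Lemma counting_fun_cut (S T : set nat) m n : m <= n ->
  (forall i, m <= i < n -> S i -> T i) ->
  counting_fun S n <= counting_fun T n + counting_fun S m.
Proof.
move=> mn ST; rewrite addnC !counting_funE (big_cat_nat _ mn) //= leq_add2l.
rewrite [leqRHS](big_cat_nat _ mn) //=; apply: leq_trans (leq_addl _ _).
rewrite big_nat_cond [leqRHS]big_nat_cond; apply: leq_sum => i /andP[imn _].
by case: (boolP (i \in S)) => // /set_mem /(ST _ imn) /mem_set ->.
Qed.

Lemma counting_fun_homo (T : set nat) : {homo counting_fun T : m n / m <= n}.
Proof.
move=> m n mn; rewrite !counting_funE (big_cat_nat _ mn) //=; exact: leq_addr.
Qed.

(** [c] is the remainder itself: the class is empty when [0 < a <= c]. *)
Definition residue_class (a c : nat) : set nat := [set n | n %% a = c].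

Lemma counting_fun_residue_class a c q :
  c < a -> counting_fun (residue_class a c) (q * a) = q.
Proof.
move=> ca; elim: q => [|q IH].
  by rewrite counting_funE big_geq.
rewrite counting_funE (@big_cat_nat _ _ _ (q * a)) ?leq_mul //=.
rewrite -counting_funE IH mulSn.
have := big_addn (op:=addn) (idx:=0) 0 (a + q * a) (q * a) xpredT
  (fun i => (i \in residue_class a c) : nat).
rewrite add0n addnK => ->; rewrite big_mkord.
rewrite (bigD1 (Ordinal ca)) //= big1 => [|i ic].
  by rewrite mem_set ?addn0 ?addn1 // /residue_class /= addnC modnMDl modn_small.
rewrite memNset //= /residue_class /= addnC modnMDl modn_small // => ic'.
by move/eqP: ic; apply; apply: val_inj.
Qed.

Section upper_density.
Variable R : realType.
Local Open Scope ring_scope.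

(** Implied by an upper density below [e], and implies one of at most [e]. *)
Definition upper_density_le (e : R) (T : set nat) : Prop :=
  \forall n \near \oo, (counting_fun T n)%:R <= e * n%:R.

Lemma zero_densityP (T : set nat) :
  zero_density R T <-> forall e, 0 < e -> upper_density_le e T.
Proof.
rewrite /zero_density /=; split => [T0 e e0|H].
  rewrite /upper_density_le; near=> n; have n0 : (0 < n%:R :> R).
    by rewrite ltr0n; near: n; exact: nbhs_infty_gt.
  rewrite -ler_pdivrMr // -[leLHS]ger0_norm ?divr_ge0 //.
  by near: n; move/cvgr0Pnorm_le : T0; exact.
apply/cvgr0Pnorm_le => e e0; near=> n.
rewrite ger0_norm ?divr_ge0 // ler_pdivrMr; last first.
  by rewrite ltr0n; near: n; exact: nbhs_infty_gt.
by near: n; exact: H.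
Unshelve. all: by end_near. Qed.

Lemma upper_density_leS e (S T : set nat) :
  S `<=` T -> upper_density_le e T -> upper_density_le e S.
Proof.
rewrite /upper_density_le => ST; apply: filterS => n; apply: le_trans.
rewrite ler_nat.
rewrite -[leqRHS]addn0 -(counting_fun_set0 n).
by apply: counting_funU => i _ /ST; left.
Qed.

Lemma upper_density_leU e1 e2 (S T : set nat) :
  upper_density_le e1 S -> upper_density_le e2 T ->
  upper_density_le (e1 + e2) (S `|` T).
Proof.
rewrite /upper_density_le; apply: filterS2 => n Sn Tn.
rewrite mulrDl (le_trans _ (lerD Sn Tn)) //.
by rewrite -natrD ler_nat; exact: counting_funU.
Qed.

(** The true density is at most [1 / 2 ^ k]; the factor 2 absorbs the incomplete last period as soon
    as [2 ^ k <= n]. *)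
Lemma upper_density_le_residue_class k c :
  upper_density_le (2 / 2 ^+ k) (residue_class (2 ^ k) c).
Proof.
rewrite /upper_density_le; near=> n.
have kn : (2 ^ k <= n)%N by near: n; exact: nbhs_infty_ge.
have k0 : (0 < 2 ^ k)%N by rewrite expn_gt0.
rewrite -natrX mulrAC ler_pdivlMr ?ltr0n // -!natrM ler_nat.
case: (ltnP c (2 ^ k)) => [ck|kc]; last first.
  rewrite (_ : residue_class _ _ = set0).
    by rewrite counting_fun_set0.
  by rewrite -subset0 => i /= ic; rewrite -ic leqNgt ltn_pmod in kc.
have := counting_fun_homo (residue_class (2 ^ k) c) (ltnW (ltn_ceil n k0)).
rewrite counting_fun_residue_class // => /(leq_mul (leqnn (2 ^ k))) nk.
have := leq_divM n (2 ^ k).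
move: nk; rewrite mulnS; lia.
Unshelve. all: by end_near. Qed.

Lemma upper_density_le_bounded e (T : set nat) N :
  0 < e -> T `<=` `I_N -> upper_density_le e T.
Proof.
move=> e0 TN; rewrite /upper_density_le; near=> n.
have NT : (counting_fun T n <= N)%N.
  have Nn : (N <= n)%N by near: n; exact: nbhs_infty_ge.
  rewrite -[leqRHS]add0n -(counting_fun_set0 n).
  apply: leq_trans (leq_add (leqnn _) (counting_fun_le T N)).
  by apply: counting_fun_cut => // i /andP[Ni _] /TN /=; rewrite ltnNge Ni.
apply: (@le_trans _ _ N%:R); first by rewrite ler_nat.
rewrite mulrC -ler_pdivrMr //; near: n.
exact: nbhs_infty_ger.
Unshelve. all: by end_near. Qed.

Lemma exp2_lt (e : R) : 0 < e -> exists k, 2 / 2 ^+ k < e.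
Proof.
move=> e0; have e20 : 0 < e / 2 by rewrite divr_gt0.
have [k _ /(_ k) /=] := near_infty_natSinv_expn_lt (PosNum e20).
move=> /(_ (leqnn k)) H; exists k; lra.
Qed.

Lemma zero_densityS (S T : set nat) :
  S `<=` T -> zero_density R T -> zero_density R S.
Proof.
move=> ST /zero_densityP T0; apply/zero_densityP => e /T0.
exact: upper_density_leS.
Qed.

Lemma zero_densityU (S T : set nat) :
  zero_density R S -> zero_density R T -> zero_density R (S `|` T).
Proof.
move=> /zero_densityP S0 /zero_densityP T0; apply/zero_densityP => e e0.
have e20 : 0 < e / 2 by rewrite divr_gt0.
by rewrite (splitr e); apply: upper_density_leU; [exact: S0|exact: T0].
Qed.

Lemma zero_density_bounded (T : set nat) N : T `<=` `I_N -> zero_density R T.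
Proof.
by move=> TN; apply/zero_densityP => e e0; exact: upper_density_le_bounded TN.
Qed.

End upper_density.

(** * Dyadic valuations, powers of two and dyadic blocks *)

Lemma dvdn_residue_class k n :
  2 ^ k %| n.+1 -> residue_class (2 ^ k) (2 ^ k).-1 n.
Proof.
have k0 : 0 < 2 ^ k by rewrite expn_gt0.
move=> /dvdnP[[|m]// nE]; have -> : n = m * 2 ^ k + (2 ^ k).-1.
  by apply: succn_inj; rewrite -addnS prednK // nE mulSnr.
by rewrite /residue_class /= modnMDl modn_small // prednK.
Qed.

(** Such an [n] satisfies [n + 1 = 2 ^ k * (2 * m + 1)] for some [m]. *)
Lemma logn2_eq n k : n %% 2 ^ k.+1 = (2 ^ k).-1 -> logn 2 n.+1 = k.
Proof.
move=> nk; rewrite (divn_eq n (2 ^ k.+1)) nk -addnS prednK ?expn_gt0 //.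
rewrite {2}expnS mulnA -mulSnr lognM ?expn_gt0 // pfactorK // logn_coprime //.
by rewrite coprime2n /= oddM andbF.
Qed.

Definition powers_of_two : set nat := [set n | n.+1 = 2 ^ logn 2 n.+1].

(** The valuation is that of [n + 1], whereas the block [[2^j, 2^(j+1))] is the one containing
    [n]. *)
Definition dyadic_blocks k (J : set nat) : set nat :=
  [set n | [/\ logn 2 n.+1 = k, J (trunc_log 2 n) & ~ powers_of_two n]].

(** From [2 ^ k] on, every power of two is a multiple of [2 ^ k], so all but finitely many lie in
    one residue class of small density. *)
Lemma powers_of_two_zero_density (R : realType) : zero_density R powers_of_two.
Proof.
apply/zero_densityP => e e0.
have e20 : (0 < e / 2)%R by rewrite divr_gt0.
have [k /ltW ke] := exp2_lt e20.
rewrite (splitr e).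
apply: (@upper_density_leS _ _ _
  (`I_(2 ^ k) `|` residue_class (2 ^ k) (2 ^ k).-1)).
  move=> n n2 ; case: (ltnP n (2 ^ k)) => kn; [by left|right].
  have kl : k <= logn 2 n.+1.
    by rewrite -(@leq_exp2l 2) // -[leqRHS]n2 (leq_trans kn).
  by apply: dvdn_residue_class; rewrite n2 dvdn_exp2l.
apply: upper_density_leU.
  exact: (@upper_density_le_bounded _ _ _ (2 ^ k)).

have := upper_density_le_residue_class R k (2 ^ k).-1.
rewrite /upper_density_le; apply: filterS => n; move/le_trans; apply.
by rewrite ler_wpM2r.
Qed.

(* The blocks [[2^j, 2^(j+1))] with [j \in J] alone witness a positive upper
   density: just below [2^(j+1)] the last block has proportion one half. *)
Lemma dyadic_blocks_not_zero_density (R : realType) k (J : set nat) :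
  (forall N, exists2 j, N <= j & J j) -> ~ zero_density R (dyadic_blocks k J).
Proof.
move=> Jinf D0.
(* With the powers of two put back, the valuation class is an exact residue class modulo [2 ^ k.+1],
   which can be counted. *)
have {}D0 : zero_density R (dyadic_blocks k J `|` powers_of_two).
  by apply: zero_densityU D0 _; exact: powers_of_two_zero_density.
set T := _ `|` _ in D0.
(* Block [j] holds [2 ^ (j - k.+1)] indices of the class, a proportion [1 / 2 ^ k.+2] of [2 ^ j.+1];
   half of this suffices. *)
have e0 : (0 < (1 / 2 ^+ k.+3) :> R)%R by rewrite divr_gt0 // exprn_gt0.
move/zero_densityP : D0 => /(_ _ e0) [N _ HN].
have [j Nj Jj] := Jinf (N + k.+1).
have : (2 ^ j.+1 >= N)%N.
  rewrite /= (leq_trans _ (ltnW (ltn_expl _ _))) //; lia.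
move=> /HN.
apply/negP; rewrite -ltNge -natrX mul1r mulrC ltr_pdivrMr ?ltr0n ?expn_gt0 //.
rewrite -natrM ltr_nat.
have /counting_fun_cut : forall i, 2 ^ j <= i < 2 ^ j.+1 ->
    residue_class (2 ^ k.+1) (2 ^ k).-1 i -> T i.
  move=> i ij ik; case: (pselect (powers_of_two i)) => [|ni]; [by right|left].
  split=> //; first exact: logn2_eq.
  by rewrite (@trunc_log_eq 2 j) // ji.
have jk : 2 ^ j = 2 ^ (j - k.+1) * 2 ^ k.+1 by rewrite -expnD subnK; last lia.
have k1 : (2 ^ k).-1 < 2 ^ k.+1 by rewrite prednK ?expn_gt0 // leq_exp2l.
have jS : 2 ^ j.+1 = 2 * 2 ^ (j - k.+1) * 2 ^ k.+1 by rewrite -mulnA -jk expnS.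
rewrite leq_exp2l // => /(_ (leqnSn j)).
have -> : counting_fun (residue_class (2 ^ k.+1) (2 ^ k).-1) (2 ^ j) =
    2 ^ (j - k.+1) by rewrite jk counting_fun_residue_class.
have -> : counting_fun (residue_class (2 ^ k.+1) (2 ^ k).-1) (2 ^ j.+1) =
    2 * 2 ^ (j - k.+1) by rewrite jS counting_fun_residue_class.
rewrite [X in _ -> X < _]jS [2 ^ k.+3]expnS [2 ^ k.+2]expnS.
have := expn_gt0 2 (j - k.+1); have := expn_gt0 2 k.+1; nia.
Qed.

(** * Interleaving sequences along dyadic valuations *)

(** Iterate the passage to the least later element of [T]. A missed [n] in [T] would bound every
    [sigma i], although [i <= sigma i]. *)
Lemma increasing_enumeration (T : set nat) :
  (forall N, exists2 n, N <= n & T n) ->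
  exists sigma : nat -> nat, increasing_seq sigma /\ range sigma = T.
Proof.
move=> Tinf.
have /choice[nx nxP] N : exists m,
    [/\ N <= m, T m & forall n, N <= n -> T n -> m <= n].
  have Tex : exists n, (n \in T) && (N <= n).
    by have [n Nn Tn] := Tinf N; exists n; rewrite mem_set.
  exists (ex_minn Tex); case: ex_minnP => m /andP[/set_mem Tm Nm] min_m.
  by split=> // n Nn Tn; apply: min_m; rewrite mem_set.
pose sigma i := iteri i (fun _ s => nx s.+1) (nx 0).
have sigma_lt i : sigma i < sigma i.+1 by have [] := nxP (sigma i).+1.
have incr : increasing_seq sigma by exact/increasing_seqP.
exists sigma; split=> //; apply/seteqP; split => [_ [i _ <-]|n Tn].
  by case: i => [|i]; [have [] := nxP 0|have [] := nxP (sigma i).+1].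
apply: contrapT => nsigma.
have sigma_le i : sigma i <= n.
  elim: i => [|i IH]; first by have [_ _] := nxP 0; exact.
  have [_ _] := nxP (sigma i).+1; apply => //.
  rewrite ltn_neqAle IH andbT; apply/eqP => in'.
  by apply: nsigma; exists i.
have le_sigma i : i <= sigma i.
  by elim: i => // i IH; rewrite (leq_ltn_trans IH).
by have := leq_trans (le_sigma n.+1) (sigma_le n.+1); rewrite ltnn.
Qed.

Lemma limit_along (X : topologicalType) (x : nat -> X) (l : X) (T : set nat) :
  (forall N, exists2 n, N <= n & T n) ->
  (forall U, nbhs l U -> exists N, forall n, N <= n -> T n -> U (x n)) ->
  exists sigma : nat -> nat,
    [/\ increasing_seq sigma, x (sigma k) @[k --> \oo] --> l & range sigma = T].
Proof.
move=> /increasing_enumeration[sigma [incr rangeT]] xT.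
exists sigma; split=> // U /xT[N HN]; exists N => //= k /= Nk.
apply: HN; last by rewrite -rangeT; exists k.
exact: leq_trans Nk (unstable.mono_leq_infl _ _).
Qed.

Lemma not_zero_density_unbounded (R : realType) (T : set nat) :
  ~ zero_density R T -> forall N, exists2 n, N <= n & T n.
Proof.
move=> nT N; apply: contrapT => TN; apply: nT.
apply: (@zero_density_bounded _ _ N) => n Tn /=.
by rewrite ltnNge; apply/negP => Nn; apply: TN; exists n.
Qed.

Definition diffuse_at (R : realType) (X : topologicalType) (y : nat -> X)
    (l : X) : Prop :=
  forall e : R, (0 < e)%R ->
    exists2 U, nbhs l U & upper_density_le e (y @^-1` U).

Section interleaving.
Variables (R : realType) (X : topologicalType).
Variables (w : nat -> nat -> X) (c : nat -> X).

Definition interleave (n : nat) : X :=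
  let k := logn 2 n.+1 in if n.+1 == 2 ^ k then c k else w k n.

Lemma interleave_powers n :
  powers_of_two n -> interleave n = c (logn 2 n.+1).
Proof. by rewrite /interleave => <-; rewrite eqxx. Qed.

Lemma interleave_not_powers n :
  ~ powers_of_two n -> interleave n = w (logn 2 n.+1) n.
Proof. by rewrite /interleave; case: eqP. Qed.

Lemma powers_of_two_pred_exp k :
  powers_of_two (2 ^ k).-1 /\ logn 2 (2 ^ k).-1.+1 = k.
Proof.
by rewrite /powers_of_two /= prednK ?expn_gt0 // pfactorK.
Qed.

Lemma diffuse_at_finite l : (forall k, diffuse_at R (w k) l) ->
  forall K (e : R), (0 < e)%R -> exists2 U, nbhs l U &
    upper_density_le e [set n | exists2 k, k < K & U (w k n)].
Proof.
move=> wl; elim=> [|K IH] e e0.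
  exists setT; first exact: filterT.
  by apply: (@upper_density_le_bounded _ _ _ 0) => // n [].
have e20 : (0 < e / 2)%R by rewrite divr_gt0.
have [U lU eU] := IH _ e20; have [V lV eV] := wl K _ e20.
exists (U `&` V); first exact: filterI.
rewrite (splitr e); apply: upper_density_leS (upper_density_leU eU eV).
move=> n [k]; rewrite ltnS leq_eqVlt => /predU1P[-> [_ Vn]|kK [Un _]].
  by right.
by left; exists k.
Qed.

Lemma interleave_diffuse_at l :
  (forall k, diffuse_at R (w k) l) -> diffuse_at R interleave l.
Proof.
(* One third of [e] each for the powers of two, the indices of valuation at least [K] (a single
   residue class), and the sequences [w k] with [k < K]. *)
move=> wl e e0; have e30 : (0 < e / 3)%R by rewrite divr_gt0.
have [K /ltW Ke] := exp2_lt e30.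
have [U lU eU] := diffuse_at_finite wl K e30.
have /zero_densityP/(_ _ e30) eP := @powers_of_two_zero_density R.
have eK := upper_density_le_residue_class R K (2 ^ K).-1.
exists U => //.
have := upper_density_leU eP (upper_density_leU eK eU).
move=> eT.
have : upper_density_le (e / 3 + (2 / 2 ^+ K + e / 3)) (interleave @^-1` U).
  apply: upper_density_leS eT => n Un.
  case: (pselect (powers_of_two n)) => [|Pn]; [by left|right].
  rewrite /= interleave_not_powers // in Un.
  case: (ltnP (logn 2 n.+1) K) => Kn; [right|left].
    by exists (logn 2 n.+1).
  by apply: dvdn_residue_class; rewrite pfactor_dvdn.
rewrite /upper_density_le; apply: filterS => n /le_trans; apply.
by apply: ler_wpM2r => //; lra.
Qed.

Lemma interleave_class_not_zero_density k (U : set X) :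
  (forall n, U (w k n)) -> ~ zero_density R (interleave @^-1` U).
Proof.
move=> wU; apply: contra_not (@dyadic_blocks_not_zero_density R k setT _).
  apply: zero_densityS => n [kn _ nP] /=.
  by rewrite interleave_not_powers // kn.
by move=> N; exists N.
Qed.

(** If [q] converges to [l] along [kappa], then [interleave] converges to [l] along the blocks
    numbered by [range kappa] in class [k], a set that is not of density zero. *)
Lemma interleave_blocks k (q : nat -> X) :
  (forall n, w k n = q (trunc_log 2 n)) ->
  ordinary_limit_points q `<=` statistical_limit_points R interleave.
Proof.
move=> wq l [kappa [incr ql]].
have Jinf N : exists2 j, N <= j & range kappa j.
  by exists (kappa N); [exact: unstable.mono_leq_infl|exists N].
have nT := @dyadic_blocks_not_zero_density R k _ Jinf.
have [U lU|sigma [? ? rangeT]] :=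
  limit_along (x := interleave) (l := l) (not_zero_density_unbounded nT).
  have [M _ HM] := ql _ lU.
  exists (2 ^ kappa M) => n nM [kn [m _ mn] nP].
  rewrite interleave_not_powers // kn wq -mn; apply: HM => /=.
  by rewrite -incr mn; exact: trunc_log_max.
by exists sigma; rewrite rangeT.
Qed.

(** * The three limit sets of the interleaved sequence *)

Variables A B C : set X.
Hypotheses (closedB : closed B) (closedC : closed C).
Hypothesis subBC : B `<=` C.
Hypotheses (cC : forall n, C (c n)) (wB : forall k n, B (w k n)).
Hypothesis limc : C `<=` ordinary_limit_points c.
Hypothesis diffw : forall k l, ~ A l -> diffuse_at R (w k) l.
Hypothesis limw : forall l, A l -> exists k q,
  (forall n, w k n = q (trunc_log 2 n)) /\ ordinary_limit_points q l.
Hypothesis densew : forall l U, B l -> nbhs l U ->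
  exists k, forall n, U (w k n).

Lemma interleave_statistical_limit_points :
  statistical_limit_points R interleave = A.
Proof.
apply/seteqP; split => [l [sigma [incr xl nz]]|l /limw[k [q [wq ql]]]].
  apply: contrapT => nAl; apply: nz; apply/zero_densityP => e e0.
  have e20 : (0 < e / 2)%R by rewrite divr_gt0.
  (* All but finitely many [sigma m] are indices of visits to [U], so the range of [sigma] inherits
     the small upper density of these. *)
  have [U lU eU] := interleave_diffuse_at (fun k => diffw k nAl) e20.
  have [N _ HN] := xl _ lU.
  have := @upper_density_le_bounded R _ `I_(sigma N) _ e20 (@subset_refl _ _).
  move=> /(upper_density_leU eU); rewrite -splitr; apply: upper_density_leS.
  move=> _ [m _ <-]; case: (leqP N m) => Nm; [left; exact: HN|right].
  by rewrite /= ltnNge -[_ <= _]/(sigma N <= sigma m)%O incr -ltnNge.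
exact: interleave_blocks wq _ ql.
Qed.

Lemma interleave_statistical_cluster_points :
  statistical_cluster_points R interleave = B.
Proof.
apply/seteqP; split => [l xl|l Bl U lU].
  apply: contrapT => nBl; apply: (xl (~` B)).
    by apply: open_nbhs_nbhs; split => //; exact: closed_openC.
  apply: zero_densityS (@powers_of_two_zero_density R) => n /= nB.
  by apply: contrapT => nP; apply: nB; rewrite interleave_not_powers.
by have [k kU] := densew Bl lU; exact: interleave_class_not_zero_density kU.
Qed.

Lemma interleave_ordinary_limit_points : ordinary_limit_points interleave = C.
Proof.
apply/seteqP; split => [l [sigma [_ xl]]|l /limc[kappa [incr cl]]].
  apply: (closed_cvg C closedC _ _ xl); apply: nearW => n.
  case: (pselect (powers_of_two (sigma n))) => nP.
    by rewrite interleave_powers.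
  by apply: subBC; rewrite interleave_not_powers.
exists (fun m => (2 ^ kappa m).-1); split.
  apply/increasing_seqP => m; rewrite -[(_ < _)%O]/(_ < _).
  rewrite -ltnS !prednK ?expn_gt0 // ltn_exp2l //.
  by move/increasing_seqP : incr; exact.
apply: cvg_trans cl; apply: near_eq_cvg; apply: nearW => m.
have [mP mE] := powers_of_two_pred_exp (kappa m).
by rewrite interleave_powers // mE.
Qed.

End interleaving.

(** * Sequences in separable metric spaces without isolated points *)

(** A metric inducing the given topology, as a plain function so that [X] keeps its own
    structure. *)
Definition compatible_metric (R : realType) (X : topologicalType)
    (d : X -> X -> R) : Prop :=
  [/\ forall x, d x x = 0%R,
      forall x y, x <> y -> (0 < d x y)%R,
      forall x y, d x y = d y x,
      forall x y z, (d x z <= d x y + d y z)%R &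
      forall x U, nbhs x U <->
        exists2 e, (0 < e)%R & forall y, (d x y < e)%R -> U y].

Lemma polish_compatible_metric (R : realType) (X : topologicalType) :
  polish R X -> exists d : X -> X -> R, compatible_metric d.
Proof.
move=> [_ [M [_ [f [g [fK _ fcont gcont]]]]]].
exists (fun x y => mdist (f x) (f y)); split.
- by move=> x; exact: mdistxx.
- move=> x y xy; rewrite mdist_gt0; apply/eqP => fxy; apply: xy.
  by rewrite -(fK x) fxy fK.
- by move=> x y; exact: metric_sym.
- by move=> x y z; exact: metric_triangle.
- move=> x U; split => [xU|[e e0 xU]].
    have : nbhs (f x) (g @^-1` U) by apply: gcont; rewrite fK.
    move=> /nbhs_ballP[e /= e0]; rewrite ballEmdist => eU; exists e => // y xy.
    by rewrite -(fK y); exact: (eU (f y)).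
  have : nbhs x (f @^-1` (ball (f x) e)) by apply: fcont; exact: nbhsx_ballx.
  by apply: filterS => y /=; rewrite ballEmdist /= => /xU.
Qed.

(** [odd (n %/ 2 ^ k)] is the binary digit of [n] of weight [2 ^ k]; it chooses the branch of the
    tree at stage [k]. *)
Lemma modn_exp2S n k :
  n %% 2 ^ k.+1 = odd (n %/ 2 ^ k) * 2 ^ k + n %% 2 ^ k.
Proof.
have k0 : 0 < 2 ^ k by rewrite expn_gt0.
rewrite {1}(divn_eq n (2 ^ k)) -{1}(odd_double_half (n %/ 2 ^ k)) mulnDl.
rewrite addnAC addnC -muln2 -mulnA -expnS modnMDl modn_small //.
have := ltn_pmod n k0; rewrite expnS; case: odd; lia.
Qed.

Lemma positive_lower_bound (R : realType) N (g : nat -> nat -> R) :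
  (forall i j, i < N -> j < N -> i <> j -> (0 < g i j)%R) ->
  exists2 e : R, (0 < e)%R &
    forall i j, i < N -> j < N -> i <> j -> (e <= g i j)%R.
Proof.
move=> g0.
(* The default 1 keeps the minimum positive when there are no pairs. *)
exists (\big[Order.min/1%R]_(p : 'I_N * 'I_N | p.1 != p.2) g p.1 p.2).
  apply: lt_bigmin => // -[i j] /= ij; apply: g0 => //.
  by move=> ij'; move/eqP: ij; apply; exact: val_inj.
move=> i j iN jN ij.
apply: (@bigmin_le_cond _ _ _ _ (Ordinal iN, Ordinal jN)).
by apply/eqP => /(congr1 val).
Qed.

Section metric_space.
Variables (R : realType) (X : topologicalType) (d : X -> X -> R).
Hypothesis metricd : compatible_metric d.
Local Open Scope ring_scope.

Let dxx x : d x x = 0. Proof. by have [] := metricd. Qed.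
Let d_gt0 x y : x <> y -> 0 < d x y.
Proof. by have [_ H _ _ _] := metricd; exact: H. Qed.
Let d_sym x y : d x y = d y x. Proof. by have [] := metricd. Qed.
Let d_triangle y x z : d x z <= d x y + d y z.
Proof. by have [] := metricd. Qed.
Let d_nbhs x U : nbhs x U <->
  exists2 e, 0 < e & forall y, d x y < e -> U y.
Proof. by have [_ _ _ _ H] := metricd; exact: H. Qed.

Let nbhs_d x e : 0 < e -> nbhs x [set y | d x y < e].
Proof. by move=> e0; apply/d_nbhs; exists e. Qed.

(* Stage [k] consists of [2^k] points indexed by residues modulo [2^k], at
   mutual distance at least [8 * E k]; each point is kept and gets one new
   neighbour within [E k] at the next stage, so that all later descendants of
   a point stay within [2 * E k] of it. *)
Lemma residue_separated_sequence (a : X) (e0 : R) :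
  isolated [set: X] = set0 -> 0 < e0 ->
  exists z : nat -> X, (forall n, d a (z n) < e0 *+ 2) /\
    forall K, exists2 delta, 0 < delta &
      forall i j, d (z i) (z j) < delta -> i = j %[mod 2 ^ K].
Proof.
move=> perfectX e00.
have /choice[nb nbP] (pe : X * R) : exists y,
    0 < pe.2 -> d pe.1 y < pe.2 /\ y <> pe.1.
  case: pe => p e /=; case: (pselect (0 < e)) => [e_gt0|//]; last by exists p.
  apply: contrapT => np.
  suff : isolated [set: X] p by rewrite perfectX.
  split; first by rewrite inE.
  exists [set y | d p y < e]; first exact: nbhs_d.
  rewrite setIT; apply/seteqP; split => [y /= py|_ ->] /=; last by rewrite dxx.
  by apply: contrapT => yp; apply: np; exists y.
pose injective_below N (P : nat -> X) :=
  forall i j, (i < N)%N -> (j < N)%N -> i <> j -> P i <> P j.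
(* The next scale is a total function of the number of points, the points and the current scale, so
   the stages can be defined before their invariants are proved. *)
have /choice[sep sepP] (t : nat * (nat -> X) * R) : exists e',
    0 < t.2 -> injective_below t.1.1 t.1.2 ->
    [/\ 0 < e', e' *+ 2 <= t.2 & forall i j, (i < t.1.1)%N -> (j < t.1.1)%N ->
       i <> j -> e' *+ 8 <= d (t.1.2 i) (t.1.2 j)].
  case: t => [[N P] e] /=.
  have [[e_gt0 injP]|nP] := pselect (0 < e /\ injective_below N P); last first.
    by exists 0 => ? ?; case: nP.
  have [|e' e'0 e'P] := @positive_lower_bound R N (fun i j => d (P i) (P j)).
    by move=> i j iN jN ij; apply: d_gt0; exact: injP.
  exists (Num.min (e / 2) (e' / 8)) => _ _.
  have m1 : Num.min (e / 2) (e' / 8) <= e / 2 by rewrite ge_min lexx.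
  have m2 : Num.min (e / 2) (e' / 8) <= e' / 8 by rewrite ge_min lexx orbT.
  split; [by rewrite lt_min !divr_gt0 //|lra|move=> i j iN jN ij].
  by have := e'P i j iN jN ij; lra.
pose grow k (t : (nat -> X) * R) : nat -> X :=
  fun n => if odd (n %/ 2 ^ k) then nb (t.1 n, t.2) else t.1 n.
pose stage := fix stage k : (nat -> X) * R :=
  if k is k'.+1 then
    let P := grow k' (stage k') in (P, sep (2 ^ k, P, (stage k').2)%N)
  else (fun=> a, e0).
pose P k := (stage k).1; pose E k := (stage k).2.
have PS k n : P k.+1 n = if odd (n %/ 2 ^ k) then nb (P k n, E k) else P k n.
  by [].
have ES k : E k.+1 = sep (2 ^ k.+1, P k.+1, E k)%N by [].
have Pmod k n m : n = m %[mod 2 ^ k] -> P k n = P k m.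
  elim: k n m => // k IH n m nm; rewrite !PS.
  have nmk : n = m %[mod 2 ^ k].
    have k2 : (2 ^ k %| 2 ^ k.+1)%N by rewrite dvdn_exp2l.
    by rewrite -(modn_dvdm n k2) nm modn_dvdm.
  have : odd (n %/ 2 ^ k) = odd (m %/ 2 ^ k).
    have k0 : (0 < 2 ^ k)%N by rewrite expn_gt0.
    by move: nm; rewrite !modn_exp2S nmk; do 2 case: odd => //=; lia.
  by rewrite (IH _ _ nmk) => ->.
pose separated k := forall i j,
  i <> j %[mod 2 ^ k] -> E k *+ 8 <= d (P k i) (P k j).
have step k n : 0 < E k -> d (P k n) (P k.+1 n) < E k.
  move=> Ek; rewrite PS; case: ifP; rewrite ?dxx // => _.
  by have [] := nbP (P k n, E k) Ek.
(* Points with the same parent are the parent and its new neighbour; points with different parents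
   start [8 * E k] apart and each moves by less than [E k]. *)
have Pinj k : 0 < E k -> separated k -> injective_below (2 ^ k.+1)%N (P k.+1).
  move=> Ek sepk i j ik jk ij.
  case: (pselect (i = j %[mod 2 ^ k])) => [ijk|/sepk far eqP].
    rewrite !PS (Pmod k i j ijk); have [_ /= nbP'] := nbP (P k j, E k) Ek.
    suff : odd (i %/ 2 ^ k) != odd (j %/ 2 ^ k).
      by case: odd; case: odd => //= _; first [exact: nbP'|exact: nesym].
    apply/eqP => odd_ij; apply: ij.
    by rewrite -(modn_small ik) -(modn_small jk) !modn_exp2S odd_ij ijk.
  have := d_triangle (P k.+1 i) (P k i) (P k j).
  have := step k i Ek; have := step k j Ek.
  by rewrite eqP (d_sym (P k.+1 j)); lra.
have grow_sep k : 0 < E k -> separated k ->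
    [/\ 0 < E k.+1, E k.+1 *+ 2 <= E k & separated k.+1].
  move=> Ek sepk; rewrite /separated ES.
  have [? ? far] := sepP (2 ^ k.+1, P k.+1, E k)%N Ek (Pinj k Ek sepk).
  split=> // i j ij; have k0 : (0 < 2 ^ k.+1)%N by rewrite expn_gt0.
  rewrite (Pmod k.+1 i (i %% 2 ^ k.+1)%N) ?modn_mod //.
  rewrite (Pmod k.+1 j (j %% 2 ^ k.+1)%N) ?modn_mod //.
  by apply: far; rewrite ?ltn_pmod.
have inv k : 0 < E k /\ separated k.
  elim: k => [|k [Ek sepk]]; last by have [] := grow_sep k Ek sepk.
  by split => // i j; rewrite !modn1.
have halve k : E k.+1 *+ 2 <= E k.
  by have [Ek sepk] := inv k; have [] := grow_sep k Ek sepk.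
(* The subtracted term makes the induction telescope: a step is below [E k], and
   [E k <= 2 * E k - 2 * E k.+1] by [halve]. *)
have tail k m n : d (P k n) (P (k + m)%N n) <= E k *+ 2 - E (k + m)%N *+ 2.
  elim: m => [|m IH]; first by rewrite addn0 dxx subrr.
  have [Ekm _] := inv (k + m)%N.
  have := d_triangle (P (k + m)%N n) (P k n) (P (k + m).+1 n).
  by have := step _ n Ekm; have := halve (k + m)%N; rewrite addnS; lra.
have tail_lt k m n : d (P k n) (P (k + m)%N n) < E k *+ 2.
  by have := tail k m n; have [] := inv (k + m)%N; lra.
(* Since [n < 2 ^ n], the digits of [n] from position [n] on vanish and its point no longer moves.
   So [P n n] is the final position. *)
have stable n m : P (n + m)%N n = P n n.
  elim: m => [|m <-]; first by rewrite addn0.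
  rewrite addnS PS divn_small // (leq_trans (ltn_expl n (ltnSn 1))) //.
  by rewrite leq_exp2l // leq_addr.
exists (fun n => P n n); split => [n|K]; first exact: (tail_lt 0%N n n).
(* Non-congruent indices are [8 * E K] apart at stage [K], and each point drifts by less than
   [2 * E K] afterwards. Stage [K + (i + j)] is late enough for both. *)
have [EK sepK] := inv K; exists (E K) => // i j; apply: contraPP => /sepK far.
apply/negP; rewrite -leNgt.
have iE : P (K + (i + j))%N i = P i i by rewrite addnCA stable.
have jE : P (K + (i + j))%N j = P j j by rewrite addnA addnC stable.
have := tail_lt K (i + j)%N i; have := tail_lt K (i + j)%N j; rewrite iE jE.
have := d_triangle (P i i) (P K i) (P K j).
by have := d_triangle (P j j) (P i i) (P K j); rewrite (d_sym (P j j)); lra.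
Qed.

(** Two terms in the ball of radius [delta / 2] about [l] are closer than [delta], so the visits to
    this ball lie in one residue class modulo [2 ^ K]. *)
Lemma diffuse_sequence (a : X) (e0 : R) :
  isolated [set: X] = set0 -> 0 < e0 ->
  exists z : nat -> X,
    (forall n, d a (z n) < e0) /\ forall l, diffuse_at R z l.
Proof.
move=> perfectX e00; have e02 : 0 < e0 / 2 by rewrite divr_gt0.
have [z [za zsep]] := residue_separated_sequence a perfectX e02.
exists z; split => [n|l e e_gt0]; first by have := za n; lra.
have [K /ltW Ke] := exp2_lt e_gt0.
have [delta delta0 close_mod] := zsep K.
exists [set y | d l y < delta / 2]; first by apply: nbhs_d; rewrite divr_gt0.
suff [c zc] : exists c, z @^-1` [set y | d l y < delta / 2] `<=`
    residue_class (2 ^ K) c.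
  have := upper_density_leS zc (@upper_density_le_residue_class R K c).
  rewrite /upper_density_le; apply: filterS => n /le_trans; apply.
  exact: ler_wpM2r.
case: (pselect (exists m, d l (z m) < delta / 2)) => [[m lm]|nz].
  exists (m %% 2 ^ K)%N => n /= ln; apply: close_mod.
  by have := d_triangle l (z n) (z m); rewrite (d_sym (z n) l); lra.
by exists 0%N => n /= ln; case: nz; exists n.
Qed.

(** The index codes a request: the exponent of 2 in [n + 1] names a point [a] of the dense set, that
    of 3 a precision, and that of 5 makes [n] large. The answer is a point of [S] that close to [a],
    or [s0] if there is none. *)
Lemma dense_sequence (S : set X) :
  separable_space X -> S !=set0 -> exists q : nat -> X, (forall n, S (q n)) /\
    forall l e, S l -> 0 < e -> forall N, exists2 n, (N <= n)%N & d l (q n) < e.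
Proof.
move=> [D /countable_injP[f finj] denseD] [s0 Ss0].
pose approx n := [set s | S s /\ exists a, [/\ D a, f a = logn 2 n.+1 &
  d a s < (logn 3 n.+1).+1%:R^-1]].
exists (fun n => xget s0 (approx n)); split => [n|l e Sl e_gt0 N].
  case: (pselect (exists s, approx n s)) => [/(xgetPex s0)[]//|napprox].
  by rewrite xgetPN // => s ns; apply: napprox; exists s.
have e20 : 0 < e / 2 by rewrite divr_gt0.
have [M _ /(_ M (leqnn M)) /= Me] := near_infty_natSinv_lt (PosNum e20).
have M0 : 0 < M.+1%:R^-1 :> R by rewrite invr_gt0.
have [||a [/interior_subset/= la Da]] :=
  denseD ([set y | d l y < M.+1%:R^-1]°).
- by exists l; exact: nbhs_d.
- exact: open_interior.
pose n := (2 ^ f a * 3 ^ M * 5 ^ N).-1.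
have nE : n.+1 = (2 ^ f a * 3 ^ M * 5 ^ N)%N.
  by rewrite /n prednK // !muln_gt0 !expn_gt0.
have n2 : logn 2 n.+1 = f a.
  by rewrite nE !lognM ?muln_gt0 ?expn_gt0 // !lognX !muln0 !addn0 muln1.
have n3 : logn 3 n.+1 = M.
  by rewrite nE !lognM ?muln_gt0 ?expn_gt0 // !lognX !muln0 addn0 add0n muln1.
exists n.
  rewrite -ltnS nE (leq_trans (ltn_expl N (isT : 1 < 5)%N)) //.
  by rewrite leq_pmull // muln_gt0 !expn_gt0.
have [_ [b [Db fb bq]]] : approx n (xget s0 (approx n)).
  by apply: xgetPex; exists l; split => //; exists a; rewrite n2 n3 d_sym.
have ab : b = a by apply: finj; rewrite ?inE // fb n2.
have := d_triangle a l (xget s0 (approx n)); move: bq; rewrite ab n3.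
by move: la Me; set r := _^-1; lra.
Qed.

Lemma dense_sequence_ordinary_limit_points (S : set X) (q : nat -> X) :
  (forall l e, S l -> 0 < e ->
     forall N, exists2 n, (N <= n)%N & d l (q n) < e) ->
  S `<=` ordinary_limit_points q.
Proof.
move=> qS l Sl.
have /choice[g gP] (t : nat * nat) : exists n,
    (t.1 <= n)%N /\ d l (q n) < t.2.+1%:R^-1.
  have [|n] := qS l t.2.+1%:R^-1 Sl _ t.1; first by rewrite invr_gt0.
  by exists n.
(* Term [m] is within [1 / (m + 1)] of [l], at an index beyond the previous one. *)
pose kappa m := iteri m (fun i s => g (s.+1, i.+1)) (g (0, 0)%N).
exists kappa; split.
  by apply/increasing_seqP => m; have [] := gP ((kappa m).+1, m.+1).
move=> U /d_nbhs[e e_gt0 eU].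
have [M _ HM] := near_infty_natSinv_lt (PosNum e_gt0).
exists M => // m /HM /= me; apply: eU; apply: lt_trans me.
case: m => [|m]; first by have [] := gP (0, 0)%N.
by have [] := gP ((kappa m).+1, m.+1).
Qed.

End metric_space.

(** * Choice of the interleaved sequences *)

Theorem corollary3p3 (R : realType) (X : topologicalType) (A B C : set X)
    (polishX : polish R X) (no_isolated : isolated [set: X] = set0)
    (subAB : A `<=` B) (subBC : B `<=` C)
    (FsigmaA : Fsigma A) (B_neq0 : B !=set0) (regclosedB : regclosed B)
    (closedC : closed C) :
  exists x : nat -> X,
    [/\ statistical_limit_points R x = A,
        statistical_cluster_points R x = B &
        ordinary_limit_points x = C].
Proof.
have [separableX _] := polishX.
have [d metricd] := polish_compatible_metric polishX.
have [_ _ _ d_triangle d_nbhs] := metricd.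
have closedB : closed B by rewrite -regclosedB; exact: closed_closure.
have intB0 : B° !=set0.
  case: B_neq0 => b; rewrite -regclosedB => /(_ setT filterT).
  by rewrite regclosedB => -[s [Bs _]]; exists s.
have [q [qB qdense]] := dense_sequence metricd separableX intB0.
have /choice[z zP] i : exists y : nat -> X,
    [/\ forall n, (d (q i) (y n) < i.+1%:R^-1)%R, forall n, B (y n) &
        forall l, diffuse_at R y l].
  have /d_nbhs[r r0 rB] := qB i.
  have i0 : (0 < i.+1%:R^-1 :> R)%R by rewrite invr_gt0.
  have m0 : (0 < Num.min r i.+1%:R^-1)%R by rewrite lt_min r0.
  have [y [qy ydiff]] := diffuse_sequence metricd (q i) no_isolated m0.
  exists y; split => // n; have := qy n; rewrite lt_min => /andP[] //.
  by move=> /rB.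
have [F closedF AF] := FsigmaA.
have /choice[y yP] k : exists y : nat -> X,
    [/\ forall n, B (y n), forall l, ~ F k l -> diffuse_at R y l &
        forall l, F k l -> exists p : nat -> X,
          (forall n, y n = p (trunc_log 2 n)) /\ ordinary_limit_points p l].
  (* For empty [F k], any sequence in [B] diffuse everywhere will do, here [z 0]. Otherwise the
     values stay in the closed set [F k], so every other point has a neighbourhood that is never
     visited. *)
  case: (pselect (F k !=set0)) => [Fk0|Fk0]; last first.
    have [_ zB zdiff] := zP 0; exists (z 0); split => // l Fkl.
    by case: Fk0; exists l.
  have [p [pF pdense]] := dense_sequence metricd separableX Fk0.
  exists (p \o trunc_log 2); split => [n|l nFl e e0|l Fl].
  - by apply: subAB; rewrite AF; exists k => //=.
  - exists (~` F k).
      by apply: open_nbhs_nbhs; split => //; exact: closed_openC.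
    by apply: (@upper_density_le_bounded _ _ _ 0) => // n /=; case.
  - exists p; split => //.
    exact: dense_sequence_ordinary_limit_points metricd _ _ pdense _ Fl.
have C0 : C !=set0 by case: B_neq0 => b /subBC; exists b.
have [c [cC cdense]] := dense_sequence metricd separableX C0.
(* Odd classes give the cluster points in [B], even classes the statistical limit points in [A]. *)
pose w k := if odd k then z k./2 else y k./2.
have wB k n : B (w k n).
  by rewrite /w; case: odd; [have [] := zP k./2|have [] := yP k./2].
exists (interleave w c); split.
- apply: interleave_statistical_limit_points => [k l nAl|l].
    rewrite /w; case: odd; first by have [_ _] := zP k./2; exact.
    have [_ + _] := yP k./2; apply; apply: contra_not nAl => Fl.
    by rewrite AF; exists k./2.
  rewrite AF => -[k _ Fl]; have [_ _ /(_ _ Fl)[p ?]] := yP k.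
  by exists k.*2, p; rewrite /w odd_double doubleK.
- apply: interleave_statistical_cluster_points => // l U.
  (* As [l] is in the closure of the interior of [B], the interior of [U] contains some [s] in that
     interior. Some [q i] is within [r / 2] of [s] with [i] so large that [z i] stays within [r / 2]
     of [q i], hence in [U]. *)
  rewrite -{1}regclosedB => Bl /nbhs_interior /Bl[s [Bs /d_nbhs[r r0 rU]]].
  have r20 : (0 < r / 2)%R by rewrite divr_gt0.
  have [N _ HN] := near_infty_natSinv_lt (PosNum r20).
  have [i /HN /= ir si] := qdense s _ Bs r20 N.
  exists i.*2.+1 => n; rewrite /w /= odd_double /= uphalf_double.
  have [/(_ n)/lt_trans/(_ ir) iz _ _] := zP i.
  by apply: rU; have := d_triangle s (q i) (z i n); lra.
- apply: (interleave_ordinary_limit_points closedC subBC) => //.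
  exact: dense_sequence_ordinary_limit_points metricd _ _ cdense.
Qed.
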